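(* Let $\mathcal{E}=(E,\ast)$ be a finite biordered set and let $u,v\in E^+$ be words such that $\overline{u}=\overline{v}$ in $\mathsf{IG}(\mathcal{E})$. Let $u=p_1\dots p_m$ and $v=q_1\dots q_s$ be arbitrary minimal r-factorisations of $u$ and $v$. Then $m=s$, and for all $1\leqslant i\leqslant m$ we have $\overline{p_i}\;\mathscr{D}\;\overline{q_i}$ in $\mathsf{IG}(\mathcal{E})$. Furthermore, $\overline{p_1}\;\mathscr{R}\;\overline{q_1}$ and $\overline{p_m}\;\mathscr{L}\;\overline{q_m}$.
   Context: For a semigroup $S$ with set of idempotents $E=E(S)$, the biordered set of $S$ is the partial algebra $\mathcal{E}_S=(E,\ast)$ in which $e\ast f$ is defined, and equal to the product $ef$ in $S$, exactly when $\{e,f\}$ is a basic pair, i.e. $\{e,f\}\cap\{ef,fe\}\neq\varnothing$ (then $ef$ and $fe$ are idempotents). A biordered set is a partial algebra $\mathcal{E}=(E,\ast)$ isomorphic to $\mathcal{E}_S$ for some semigroup $S$; it is finite if $E$ is finite ($S$ may be infinite). The free idempotent generated semigroup $\mathsf{IG}(\mathcal{E})$ is the semigroup presented by generators $\overline{E}=\{\overline{e}: e\in E\}$ and relations $\overline{e}\,\overline{f}=\overline{e\ast f}$ for all basic pairs $\{e,f\}$. $E^+$ is the free semigroup on $E$, and for $w\in E^+$, $\overline{w}$ denotes the image of $w$ under the natural homomorphism $E^+\to\mathsf{IG}(\mathcal{E})$ sending each $e$ to $\overline e$. $\mathscr{R},\mathscr{L},\mathscr{D}$ are Green's relations on $\mathsf{IG}(\mathcal{E})$.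 An element $a$ of a semigroup is regular if $a=aba$ for some $b$. An r-factorisation of $w\in E^+$ is a factorisation $w=w_1\dots w_m$ into non-empty words such that each $\overline{w_i}$ is a regular element of $\mathsf{IG}(\mathcal{E})$. It is minimal if it is minimal with respect to coarsening among r-factorisations of $w$; equivalently, if for all $1\leqslant i\leqslant j\leqslant m$, regularity of $\overline{w_i\dots w_j}$ implies $i=j$. *)

(* Defs.v *)
From HB Require Import structures.
From mathcomp Require Import all_boot.
From mathcomp Require Import boolp.

Set Implicit Arguments.
Unset Strict Implicit.
Unset Printing Implicit Defensive.

Local Open Scope group_scope.
Local Open Scope quotient_scope.

Section Semigroups.
Variable S : semigroupType.
Implicit Types a b x y : S.

Definition regular a := exists b, a = a * b * a.

(* Inclusion of principal one-sided ideals: a S^1 in b S^1, S^1 a in S^1 b. *)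
Definition leR a b := a = b \/ exists x, a = b * x.
Definition leL a b := a = b \/ exists x, a = x * b.

Definition greenR a b := leR a b /\ leR b a.
Definition greenL a b := leL a b /\ leL b a.
(* D as the composite of R and L, which commute. *)
Definition greenD a b := exists2 c, greenR a c & greenL c b.

Definition idem := {e : S | e * e == e}.

Definition basic_pair a b :=
  [|| a * b == a, a * b == b, b * a == a | b * a == b].

(* The partial operation of the biordered set of S; None means undefined. The
   [insub] below never fails on basic pairs, see [biorder_opE]. *)
Definition biorder_op (e f : idem) : option idem :=
  if basic_pair (val e) (val f)
  then insub (val e * val f) : option {e : S | e * e == e} else None.

Lemma basic_pair_idem (e f : idem) : basic_pair (val e) (val f) ->
  (val e * val f) * (val e * val f) == val e * val f.
Proof.
case: e f => [e /eqP he] [f /eqP hf] /= /or4P[] /eqP h.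
- by rewrite h he.
- by rewrite h hf.
- by rewrite mulgA -[e * f * e]mulgA h he.
- by rewrite mulgA -[e * f * e]mulgA h -mulgA hf.
Qed.

Lemma biorder_opE (e f : idem) : basic_pair (val e) (val f) ->
  exists2 g, biorder_op e f = Some g & val g = val e * val f.
Proof.
move=> h; rewrite /biorder_op h.
by case: insubP => [g _ hg|]; [exists g | rewrite basic_pair_idem].
Qed.

End Semigroups.

Definition biordered (E : Type) (op : E -> E -> option E) : Prop :=
  exists (S : semigroupType) (phi : E -> idem S),
    bijective phi /\
    forall e f, omap phi (op e f) = biorder_op (phi e) (phi f).

(* The free semigroup E^+. *)
Section Words.
Variable E : choiceType.

Record word := Word { letters : seq E; _ : letters != [::] }.
HB.instance Definition _ := [isSub for letters].
HB.instance Definition _ := [Choice of word by <:].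

Fact word_mul_subproof (u v : word) : val u ++ val v != [::].
Proof. by case: u => [[]]. Qed.
Definition word_mul (u v : word) : word := Word (word_mul_subproof u v).

Fact word_mulA : associative word_mul.
Proof. by move=> u v w; apply: val_inj; rewrite /= catA. Qed.
HB.instance Definition _ := isSemigroup.Build word word_mulA.

Definition letter (e : E) : word := @Word [:: e] isT.

End Words.

Section IG.
Variables (E : choiceType) (op : E -> E -> option E).

(* The least congruence on E^+ containing the defining relations; [op] is
   defined exactly on (ordered) basic pairs. *)
Inductive ig_cong : word E -> word E -> Prop :=
| ig_rel e f g : op e f = Some g -> ig_cong (letter e * letter f) (letter g)
| ig_refl u : ig_cong u u
| ig_sym u v : ig_cong u v -> ig_cong v u
| ig_trans u v w : ig_cong u v -> ig_cong v w -> ig_cong u w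
| ig_mul u u' v v' :
    ig_cong u u' -> ig_cong v v' -> ig_cong (u * v) (u' * v').

Definition ig_rel_bool : rel (word E) := fun u v => `[< ig_cong u v >].

Fact ig_rel_bool_refl : reflexive ig_rel_bool.
Proof. by move=> u; apply/asboolP/ig_refl. Qed.
Fact ig_rel_bool_sym : symmetric ig_rel_bool.
Proof. by move=> u v; apply/asboolP/asboolP; apply: ig_sym. Qed.
Fact ig_rel_bool_trans : transitive ig_rel_bool.
Proof. by move=> v u w /asboolP uv /asboolP vw; apply/asboolP/(ig_trans uv). Qed.

Canonical ig_equiv :=
  EquivRel ig_rel_bool ig_rel_bool_refl ig_rel_bool_sym ig_rel_bool_trans.

Definition IG : Type := {eq_quot ig_equiv}.
HB.instance Definition _ := Choice.on IG.

Definition bar (w : word E) : IG := \pi_({eq_quot ig_equiv}) w.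

Lemma bar_eqP u v : bar u = bar v <-> ig_cong u v.
Proof. by split=> [/eqmodP/asboolP // | h]; apply/eqmodP/asboolP. Qed.

Definition ig_repr (x : IG) : word E := repr (x : {eq_quot ig_equiv}).

Lemma ig_reprK x : bar (ig_repr x) = x.
Proof. exact: reprK. Qed.

Definition IG_mul (x y : IG) : IG := bar (ig_repr x * ig_repr y).

Lemma bar_mul_subproof u v : IG_mul (bar u) (bar v) = bar (u * v).
Proof. by apply/bar_eqP/ig_mul; apply/bar_eqP/ig_reprK. Qed.

Fact IG_mulA : associative IG_mul.
Proof.
move=> x y z; rewrite -[x]ig_reprK -[y]ig_reprK -[z]ig_reprK.
by rewrite !bar_mul_subproof mulgA.
Qed.
HB.instance Definition _ := isSemigroup.Build IG IG_mulA.

Lemma barM u v : bar (u * v) = bar u * bar v.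
Proof. by rewrite -bar_mul_subproof. Qed.

End IG.

Section Factorisations.
Variables (E : choiceType) (op : E -> E -> option E).
Implicit Types (w : word E) (ps qs : seq (word E)).

(* The concatenation of a list of words; a plain sequence, as the list of
   factors may be empty. *)
Definition concat ps : seq E := flatten (map val ps).

Definition r_factorisation w ps :=
  concat ps = val w /\ forall p, p \in ps -> regular (bar op p).

(* [qs] arises from [ps] by multiplying together blocks of consecutive
   factors; the blocks are automatically non-empty, as words are. *)
Definition coarsening qs ps :=
  exists2 pss : seq (seq (word E)),
    ps = flatten pss & map val qs = map concat pss.

Definition minimal_r_factorisation w ps :=
  r_factorisation w ps /\
  forall qs, r_factorisation w qs -> coarsening qs ps -> qs = ps.

Lemma minimal_r_factorisationP w ps : r_factorisation w ps ->
  minimal_r_factorisation w ps <->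
  forall ps1 b ps2 (q : word E), ps = ps1 ++ b ++ ps2 -> val q = concat b ->
    regular (bar op q) -> size b = 1%N.
Proof.
have concat_cat s t : concat (s ++ t) = concat s ++ concat t.
  by rewrite /concat map_cat flatten_cat.
have concat1 s : map concat [seq [:: p] | p <- s] = map val s.
  by elim: s => //= p s ->; rewrite /concat /= cats0.
have flatten1 (s : seq (word E)) : flatten [seq [:: p] | p <- s] = s.
  by elim: s => //= p s ->.
move=> [hw hr]; split=> [[_ hmin] ps1 b ps2 q eps qb rq | hreg].
  have eq_ps : ps1 ++ q :: ps2 = ps.
    apply: hmin; first split.
    - rewrite concat_cat -[q :: ps2]cat1s concat_cat {2}/concat /= cats0 qb.
      by rewrite -!concat_cat -eps.
    - move=> p; rewrite mem_cat inE => /or3P[h|/eqP->//|h]; apply: hr.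
        by rewrite eps mem_cat h.
      by rewrite eps !mem_cat h !orbT.
    - exists ([seq [:: p] | p <- ps1] ++ b :: [seq [:: p] | p <- ps2]).
        by rewrite flatten_cat /= !flatten1.
      by rewrite !map_cat /= !concat1 qb.
  move/(congr1 size): eq_ps; rewrite eps !size_cat /= => /addnI.
  by rewrite -add1n => /addIn.
split=> // qs [_ hrq] [pss eps eqs].
suff sz1 b : b \in pss -> size b = 1%N.
  apply: (inj_map val_inj); rewrite eqs eps.
  elim: pss sz1 {eps eqs} => //= b pss IH sz1.
  rewrite IH; last by move=> c hc; apply: sz1; rewrite inE hc orbT.
  have := sz1 b (mem_head _ _); case: b {sz1} => [|p []] //= _.
  by rewrite /concat /= cats0.
move=> hb; have /mapP[q hq qb] : concat b \in map val qs.
  by rewrite eqs map_f.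
have /hrq rq := hq.
case/splitPr: hb eps => s t eps.
apply: (hreg (flatten s) b (flatten t) q) => //.
by rewrite eps flatten_cat.
Qed.

End Factorisations.

(* Main.v *)
From HB Require Import structures.
Require Import Defs.
From mathcomp Require Import all_boot.
From mathcomp Require Import boolp.

Set Implicit Arguments.
Unset Strict Implicit.
Unset Printing Implicit Defensive.

Local Open Scope group_scope.

(** Call an occurrence of a letter s in a word w = a s b a seed when a s is
    L-related and s b is R-related to s in IG(E).  A word with a seed represents
    a regular element, because s is idempotent.  The proof replaces regularity
    by the existence of a seed, which can be followed through rewriting.

    Rewriting.  The biordered set enters through the relations e e = e, and
    through the fact that a defining relation e f = g entails g R e or g L f in
    IG(E).  Consequently having a seed depends only on the element represented
    ([seeded_ev]), and even only on its D-class ([seeded_eqD]).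

    Minimal factorisations into seeded words.  Consider the move that replaces
    two adjacent factors p, p' by r, r' with p R r, p' L r' and p p' = r r'.
    It changes the element represented by a block of consecutive factors only
    within its D-class, so it preserves minimality; it also changes the
    products of initial (final) blocks only within their R-class (L-class).
    The relation [sim] records these invariants.  Two facts show that any two
    minimal factorisations of the same element are [sim]-related
    ([minimal_sim_ev]):
    - if two minimal factorisations of one word start with factors p and p x,
      the position of the seeds forces p R p x, and forces the second factor of
      the former to be x y with y L x y, so that a move makes the first factors
      equal ([minimal_unique]);
    - if a rewriting step e f -> g happens across the boundary between p e and
      f q, say with g R e, a seed at f would give p e f q R p e and contradict
      minimality; so the seed of f q lies in q, q L f q, and p g, q is obtained
      by a move ([transfer_step]).

    Regular implies seeded ([regular_seeded]).  Let w = w x w in IG(E), and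
    compare minimal factorisations p_1, ..., p_m of w and q_1, ..., q_m of
    the word w x w.  Take the first k such that q_1 ... q_k covers the first
    copy of w.  Then p_1 ... p_k R w.  If k < m, the element p_1 ... p_k is
    again regular and induction gives k = 1, whence p_1 R p_1 p_2, against
    minimality.  If k = m, then q_m ends with w, and p_m L q_m gives
    p_m L p_{m-1} p_m unless m = 1.  So m = 1, and w is seeded.

    Hence minimal r-factorisations are the minimal factorisations into seeded
    words, and the theorem reads off the invariants in [sim]. *)

(** * Green's relations in a monoid *)

Section GreenMonoid.
Variable M : monoidType.
Implicit Types a b c x y : M.

Definition ordR a b := exists x, a = b * x.
Definition ordL a b := exists x, a = x * b.
Definition eqR a b := ordR a b /\ ordR b a.
Definition eqL a b := ordL a b /\ ordL b a.
Definition eqD a b := exists2 c, eqR a c & eqL c b.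

Lemma ordR_refl a : ordR a a. Proof. by exists 1; rewrite mulg1. Qed.
Lemma ordL_refl a : ordL a a. Proof. by exists 1; rewrite mul1g. Qed.

Lemma ordR_trans b a c : ordR a b -> ordR b c -> ordR a c.
Proof. by move=> [x ->] [y ->]; exists (y * x); rewrite mulgA. Qed.

Lemma ordL_trans b a c : ordL a b -> ordL b c -> ordL a c.
Proof. by move=> [x ->] [y ->]; exists (x * y); rewrite mulgA. Qed.

Lemma ordR_mulr a x : ordR (a * x) a. Proof. by exists x. Qed.
Lemma ordL_mull a x : ordL (x * a) a. Proof. by exists x. Qed.

Lemma ordR_mull c a b : ordR a b -> ordR (c * a) (c * b).
Proof. by move=> [x ->]; exists x; rewrite mulgA. Qed.

Lemma ordL_mulr c a b : ordL a b -> ordL (a * c) (b * c).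
Proof. by move=> [x ->]; exists x; rewrite mulgA. Qed.

Lemma eqR_refl a : eqR a a. Proof. by split; apply: ordR_refl. Qed.
Lemma eqL_refl a : eqL a a. Proof. by split; apply: ordL_refl. Qed.
Lemma eqR_sym a b : eqR a b -> eqR b a. Proof. by case. Qed.
Lemma eqL_sym a b : eqL a b -> eqL b a. Proof. by case. Qed.

Lemma eqR_trans b a c : eqR a b -> eqR b c -> eqR a c.
Proof.
by move=> [ab ba] [bc cb]; split; [apply: ordR_trans bc | apply: ordR_trans ba].
Qed.

Lemma eqL_trans b a c : eqL a b -> eqL b c -> eqL a c.
Proof.
by move=> [ab ba] [bc cb]; split; [apply: ordL_trans bc | apply: ordL_trans ba].
Qed.

Lemma eqR_mull c a b : eqR a b -> eqR (c * a) (c * b).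
Proof. by case=> ab ba; split; apply: ordR_mull. Qed.

Lemma eqL_mulr c a b : eqL a b -> eqL (a * c) (b * c).
Proof. by case=> ab ba; split; apply: ordL_mulr. Qed.

(** Green's relations L and R commute; this makes D symmetric and transitive. *)
Lemma eqL_eqR_comm a b c : eqL a c -> eqR c b -> eqD a b.
Proof.
move=> [[t ac] [s ca]] [[y cb] [x bc]].
exists (a * x); split.
- by exists y; rewrite ac -2!mulgA (mulgA c) -bc -cb.
- exact: ordR_mulr.
- by exists t; rewrite bc ac mulgA.
- by exists s; rewrite bc ca mulgA.
Qed.

Lemma eqD_R a b : eqR a b -> eqD a b.
Proof. by move=> ab; exists b => //; apply: eqL_refl. Qed.

Lemma eqD_L a b : eqL a b -> eqD a b.
Proof. by move=> ab; exists a => //; apply: eqR_refl. Qed.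

Lemma eqD_sym a b : eqD a b -> eqD b a.
Proof. by case=> c ac cb; apply: eqL_eqR_comm (eqL_sym cb) (eqR_sym ac). Qed.

Lemma eqD_trans b a c : eqD a b -> eqD b c -> eqD a c.
Proof.
case=> x ax xb [y bY yc]; have [z xz zy] := eqL_eqR_comm xb bY.
by exists z; [apply: eqR_trans xz | apply: eqL_trans yc].
Qed.

End GreenMonoid.

(** * Adjoining an identity to a semigroup *)

Section Adjoin.
Variable S : semigroupType.

(** The monoid S^1, in which the one-sided preorders need no special case. The
    identity is new even if S has one. *)
Definition adjoin1 : Type := option S.
HB.instance Definition _ := Choice.on adjoin1.

Definition adjoin1_mul (x y : adjoin1) : adjoin1 :=
  match x, y with
  | Some a, Some b => Some (a * b)
  | None, _ => y
  | _, None => x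
  end.

Fact adjoin1_mulA : associative adjoin1_mul.
Proof. by move=> [a|] [b|] [c|] //=; rewrite mulgA. Qed.
Fact adjoin1_mul1 : left_id None adjoin1_mul.
Proof. by case. Qed.
Fact adjoin1_1mul : right_id None adjoin1_mul.
Proof. by case. Qed.

HB.instance Definition _ :=
  isMonoid.Build adjoin1 adjoin1_mulA adjoin1_mul1 adjoin1_1mul.

Definition in1 (a : S) : adjoin1 := Some a.

Lemma in1M a b : in1 (a * b) = in1 a * in1 b. Proof. by []. Qed.

Lemma in1_inj : injective in1. Proof. by move=> a b []. Qed.

Lemma leR_ordR a b : ordR (in1 a) (in1 b) -> leR a b.
Proof. by case=> -[x|] h; [right; exists x | left]; apply: in1_inj. Qed.

Lemma leL_ordL a b : ordL (in1 a) (in1 b) -> leL a b.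
Proof. by case=> -[x|] h; [right; exists x | left]; apply: in1_inj. Qed.

Lemma greenR_eqR a b : eqR (in1 a) (in1 b) -> greenR a b.
Proof. by case=> *; split; apply: leR_ordR. Qed.

Lemma greenL_eqL a b : eqL (in1 a) (in1 b) -> greenL a b.
Proof. by case=> *; split; apply: leL_ordL. Qed.

Lemma greenD_eqD a b : eqD (in1 a) (in1 b) -> greenD a b.
Proof.
case=> -[c|] ac cb; last by case: ac => _ [[]].
by exists c; [apply: greenR_eqR | apply: greenL_eqL].
Qed.

End Adjoin.

(** * Splitting concatenations *)

Section Split.
Variable T : Type.

Lemma cat_eq_split (u v a b : seq T) : u ++ v = a ++ b ->
  (exists2 z, a = u ++ z & v = z ++ b) \/ (exists2 z, u = a ++ z & b = z ++ v).
Proof.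
elim: u a => [|x u IH] [|y a] /=.
- by move=> ->; left; exists [::].
- by move=> ->; left; exists (y :: a).
- by move=> <-; right; exists (x :: u).
- case=> -> /IH [] [z -> ->]; first by left; exists z.
  by right; exists z.
Qed.

Lemma cat_cons_split (u v a : seq T) s b : u ++ v = a ++ s :: b ->
  (exists2 z, a = u ++ z & v = z ++ s :: b) \/
  (exists2 z, u = a ++ s :: z & b = z ++ v).
Proof.
case/cat_eq_split => [[z -> ->]|[[|t z] -> /=]]; first by left; exists z.
  by move=> <-; left; exists [::]; rewrite ?cats0.
by case=> <- ->; right; exists z.
Qed.

Lemma flatten_locate (ps : seq (seq T)) c s z : flatten ps = c ++ s :: z ->
  exists ps1 c' b ps2, [/\ ps = ps1 ++ (c' ++ s :: b) :: ps2,
    c = flatten ps1 ++ c' & z = b ++ flatten ps2].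
Proof.
elim: ps c => [|p ps IH] c /=; first by case: c.
case/cat_cons_split=> [[y -> /IH]|[y -> ->]]; last by exists [::], c, y, ps.
move=> [ps1 [c' [b [ps2 [-> -> ->]]]]].
by exists (p :: ps1), c', b, ps2; split=> //=; rewrite catA.
Qed.

End Split.

(** * Words and their seeds *)

Section Ig.
Variables (E : choiceType) (op : E -> E -> option E).
Implicit Types (u v w a b : seq E) (e f g s : E).

Notation M := (adjoin1 (IG op)).

(** Letters and words, the empty one included, in IG(E)^1. *)
Definition gen e : M := in1 (bar op (letter e)).
Definition ev w : M := foldr (fun e x => gen e * x) 1 w.

Lemma ev_cat u v : ev (u ++ v) = ev u * ev v.
Proof. by elim: u => [|e u IH] /=; rewrite ?mul1g // IH mulgA. Qed.

Lemma ev_val (w : word E) : ev (val w) = in1 (bar op w).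
Proof.
case: w => l; elim: l => [//|e [|f l] IH] he.
  by rewrite /= mulg1 /gen; congr (in1 (bar op _)); apply: val_inj.
have eqw : Word he = letter e * @Word _ (f :: l) isT by apply: val_inj.
by rewrite eqw barM in1M -IH.
Qed.

(** It suffices to check an equivalence relation on words on the rewriting
    steps, the congruence closure being absorbed by the contexts x, y. *)
Lemma ev_ind (Q : seq E -> seq E -> Prop) :
    (forall u, Q u u) -> (forall u v, Q u v -> Q v u) ->
    (forall u v w, Q u v -> Q v w -> Q u w) ->
    (forall x e f g y, op e f = Some g -> Q (x ++ e :: f :: y) (x ++ g :: y)) ->
  forall u v, ev u = ev v -> Q u v.
Proof.
move=> Qr Qs Qt Qstep.
have ctx (u v : word E) : ig_cong op u v ->
    forall x y, Q (x ++ val u ++ y) (x ++ val v ++ y).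
  elim=> {u v} [e f g efg|u|u v _ IH|u v w _ IHu _ IHv|u u' v v' _ IHu _ IHv] x y.
  - exact: Qstep.
  - exact: Qr.
  - by apply: Qs.
  - exact: Qt (IHu _ _) (IHv _ _).
  - rewrite /= -!catA; apply: Qt (IHu _ _) _.
    by have := IHv (x ++ val u') y; rewrite -!catA.
move=> u v; case: u => [|e u]; case: v => [|f v] //.
- by rewrite (ev_val (@Word _ (f :: v) isT)).
- by rewrite (ev_val (@Word _ (e :: u) isT)).
rewrite (ev_val (@Word _ (f :: v) isT)) (ev_val (@Word _ (e :: u) isT)).
move=> /in1_inj /bar_eqP/ctx/(_ [::] [::]).
by rewrite /= !cats0.
Qed.

(** The letter s is a seed of the word a s b; only half of a s L s and s b R s
    is written, as the other half always holds. *)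
Definition seeded w := exists a s b,
  [/\ w = a ++ s :: b, ordL (gen s) (ev a * gen s) & ordR (gen s) (gen s * ev b)].

Hypothesis op_idem : forall e, op e e = Some e.
Hypothesis op_RL :
  forall e f g, op e f = Some g -> op g e = Some e \/ op f g = Some f.

Lemma gen_op e f g : op e f = Some g -> gen g = gen e * gen f.
Proof.
by move=> efg; rewrite -in1M -barM; congr in1; apply/esym/bar_eqP/ig_rel.
Qed.

Lemma gen_idem e : gen e * gen e = gen e.
Proof. by rewrite -(gen_op (op_idem e)). Qed.

Lemma gen_RL e f g :
  op e f = Some g -> eqR (gen g) (gen e) \/ eqL (gen g) (gen f).
Proof.
move=> efg; rewrite {1}(gen_op efg); case: (op_RL efg) => /gen_op h; [left|right].
  by split; [apply: ordR_mulr | rewrite -(gen_op efg) h; apply: ordR_mulr].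
rewrite (gen_op efg); split; first exact: ordL_mull.
by rewrite -(gen_op efg) h; apply: ordL_mull.
Qed.

(** A seed of x e f y at e or f becomes a seed of x g y at g. Conversely, a seed
    at g comes from one at e if g R e, and from one at f if g L f. *)
Lemma seeded_step x e f g y : op e f = Some g ->
  seeded (x ++ e :: f :: y) <-> seeded (x ++ g :: y).
Proof.
move=> efg; have Eg := gen_op efg; split=> -[a [s [b [eqw hL hR]]]].
- case: (cat_eq_split eqw) => -[[|c z] eqa /= eqb].
  + case: eqb => ? ?; subst s b; rewrite eqa cats0 /= in hL.
    exists x, g, y; split=> //; rewrite Eg.
      by rewrite mulgA; apply: ordL_mulr.
    apply: ordR_trans (ordR_mulr _ _) _.
    by move: hR; rewrite /= !mulgA.
  + case: eqb => ? eqb; subst c; case: z eqb eqa => [|c z] /=.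
      case=> ? ? eqa; subst s b a.
      exists x, g, y; split=> //; rewrite Eg.
        apply: ordL_trans (ordL_mull _ _) _.
        by move: hL; rewrite ev_cat /= mulg1 -!mulgA.
      by rewrite -mulgA; apply: ordR_mull.
    case=> ? eqb eqa; subst c y a; exists (x ++ g :: z), s, b.
    split=> //; first by rewrite -catA.
    by move: hL; rewrite !ev_cat /= Eg !mulgA.
  + case: eqb => ? ?; subst s b; rewrite cats0 in eqa; subst x.
    exists a, g, y; split=> //; rewrite Eg.
      by rewrite mulgA; apply: ordL_mulr.
    apply: ordR_trans (ordR_mulr _ _) _.
    by move: hR; rewrite /= !mulgA.
  + case: eqb => ? ?; subst c b x; exists a, s, (z ++ g :: y).
    split=> //; first by rewrite -catA.
    by move: hR; rewrite !ev_cat /= Eg !mulgA.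
- (* the case of a seed at g *)
  have seed_at : s = g -> seeded (a ++ e :: f :: b).
    move=> ?; subst s; case: (gen_RL efg) => -[h1 h2].
      exists a, e, (f :: b); split=> //=.
        case: h2 => z2 e2; case: hL => t h.
        by exists t; rewrite e2 (mulgA (ev a)) (mulgA t) -h.
      by rewrite mulgA -Eg; apply: ordR_trans h2 hR.
    exists (a ++ [:: e]), f, b; split=> //=; first by rewrite -catA.
      by rewrite ev_cat /= mulg1 -mulgA -Eg; apply: ordL_trans h2 hL.
    case: h2 => z2 e2; case: hR => t h.
    by exists t; rewrite e2 {1}h !mulgA.
  case: (cat_eq_split eqw) => -[[|c z] eqa /= eqb].
  + by case: eqb => ? ?; subst s b; rewrite cats0 in eqa; subst a; apply: seed_at.
  + case: eqb => ? ?; subst c y a; exists (x ++ e :: f :: z), s, b.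
    split=> //; first by rewrite -catA.
    by move: hL; rewrite !ev_cat /= Eg !mulgA.
  + by case: eqb => ? ?; subst s b; rewrite cats0 in eqa; subst x; apply: seed_at.
  + case: eqb => ? ?; subst c b x; exists a, s, (z ++ e :: f :: y).
    split=> //; first by rewrite -catA.
    by move: hR; rewrite !ev_cat /= Eg !mulgA.
Qed.

Lemma seeded_ev u v : ev u = ev v -> seeded u -> seeded v.
Proof.
suff: forall u v, ev u = ev v -> (seeded u <-> seeded v).
  by move=> H /H [].
by apply: ev_ind => [//|? ? -> //|? ? ? -> -> //|]; apply: seeded_step.
Qed.

Lemma ev_surj (x : M) : exists w, ev w = x.
Proof.
case: x => [x|]; last by exists [::].
by exists (val (ig_repr x)); rewrite ev_val ig_reprK.
Qed.

(** Let u = a s b with seed s. As s b is a left multiple of u, and u x y = u,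
    also s b x y = s b, so that s is a seed of a s b x. *)
Lemma seeded_eqR u v : eqR (ev u) (ev v) -> seeded u -> seeded v.
Proof.
move=> [[y uv] [x vu]] [a [s [b [equ [t hL] [t' hR]]]]].
have [w hw] := ev_surj x.
apply: (@seeded_ev (u ++ w)); first by rewrite ev_cat hw.
exists a, s, (b ++ w); split.
- by rewrite equ -catA.
- by exists t.
- have uE : ev u = ev a * gen s * ev b by rewrite equ ev_cat /= !mulgA.
  exists (y * t'); rewrite {1}hR {1}hL ev_cat hw.
  have -> : t * (ev a * gen s) * ev b * t' = t * ev u * t' by rewrite uE !mulgA.
  by rewrite uv vu uE [in RHS]hL !mulgA.
Qed.

Lemma seeded_eqL u v : eqL (ev u) (ev v) -> seeded u -> seeded v.
Proof.
move=> [[y uv] [x vu]] [a [s [b [equ [t hL] [t' hR]]]]].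
have [w hw] := ev_surj x.
apply: (@seeded_ev (w ++ u)); first by rewrite ev_cat hw.
exists (w ++ a), s, b; split.
- by rewrite equ -catA.
- have uE : ev u = ev a * (gen s * ev b) by rewrite equ ev_cat.
  exists (t * y); rewrite {1}hL {1}hR ev_cat hw.
  have -> : t * (ev a * (gen s * ev b * t')) = t * ev u * t' by rewrite uE !mulgA.
  by rewrite uv vu uE [in RHS]hR !mulgA.
- by exists t'.
Qed.

Lemma seeded_eqD u v : eqD (ev u) (ev v) -> seeded u -> seeded v.
Proof.
case=> x; have [w <-] := ev_surj x.
by move=> uw wv /(seeded_eqR uw)/(seeded_eqL wv).
Qed.

Implicit Types (p q r : seq E) (ps qs : seq (seq E)).

Lemma seeded0 : ~ seeded [::].
Proof. by case=> -[|? ?] [s [b []]]. Qed.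

(** * Factorisations and boundary moves *)

(** The invariants of boundary moves between lists of factors. The equality of
    the total products makes the relation stable under prepending a factor, as
    L-related elements need not stay so after multiplication on the left. *)
Record sim ps qs : Prop := Sim {
  sim_size : size ps = size qs;
  sim_ev : ev (flatten ps) = ev (flatten qs);
  sim_prefix : forall k, eqR (ev (flatten (take k ps))) (ev (flatten (take k qs)));
  sim_suffix : forall i, eqL (ev (flatten (drop i ps))) (ev (flatten (drop i qs)));
  sim_block : forall i k, eqD (ev (flatten (take k (drop i ps))))
                              (ev (flatten (take k (drop i qs)))) }.

Lemma sim_refl ps : sim ps ps.
Proof.
split=> // *; [exact: eqR_refl | exact: eqL_refl | exact/eqD_R/eqR_refl].
Qed.

Lemma sim_sym ps qs : sim ps qs -> sim qs ps.
Proof.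
case=> *; split=> // *; [exact: eqR_sym | exact: eqL_sym | exact: eqD_sym].
Qed.

Lemma sim_trans qs ps rs : sim ps qs -> sim qs rs -> sim ps rs.
Proof.
case=> s1 e1 p1 l1 d1 [s2 e2 p2 l2 d2]; split=> *.
- by rewrite s1.
- by rewrite e1.
- exact: eqR_trans (p1 _) (p2 _).
- exact: eqL_trans (l1 _) (l2 _).
- exact: eqD_trans (d1 _ _) (d2 _ _).
Qed.

Lemma sim_cons p ps qs : sim ps qs -> sim (p :: ps) (p :: qs).
Proof.
case=> s1 e1 p1 l1 d1.
have hp k : eqR (ev (flatten (take k (p :: ps)))) (ev (flatten (take k (p :: qs)))).
  case: k => [|k] /=; first exact: eqR_refl.
  by rewrite !ev_cat; apply: eqR_mull.
split=> //=.
- by rewrite s1.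
- by rewrite !ev_cat e1.
- by case=> [|i] //=; rewrite !ev_cat e1; apply: eqL_refl.
- by case=> [|i] k; [apply/eqD_R/hp | apply: d1].
Qed.

Lemma sim_cat ps1 ps qs : sim ps qs -> sim (ps1 ++ ps) (ps1 ++ qs).
Proof. by elim: ps1 => //= p ps1 IH h; apply/sim_cons/IH. Qed.

(** The boundary move: every block that is cut between the two factors ends in p
    or starts with p', and is changed within its R-class or L-class. *)
Lemma sim_move p p' r r' ps : eqR (ev p) (ev r) -> eqL (ev p') (ev r') ->
  ev (p ++ p') = ev (r ++ r') -> sim (p :: p' :: ps) (r :: r' :: ps).
Proof.
move=> hR hL hE.
have hp k : eqR (ev (flatten (take k [:: p, p' & ps])))
                (ev (flatten (take k [:: r, r' & ps]))).
  case: k => [|[|k]] /=; first exact: eqR_refl.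
    by rewrite ?take0 /= !cats0.
  by rewrite !catA !ev_cat -ev_cat hE ev_cat; apply: eqR_refl.
split=> //=.
- by rewrite !catA !ev_cat -ev_cat hE ev_cat.
- case=> [|[|i]] /=; last exact: eqL_refl.
    by rewrite !catA !ev_cat -ev_cat hE ev_cat; apply: eqL_refl.
  by rewrite !ev_cat; apply: eqL_mulr.
- case=> [|[|i]] k; [exact/eqD_R/hp| |exact/eqD_R/eqR_refl].
  apply: eqD_L; case: k => [|k] /=; first exact: eqL_refl.
  by rewrite !ev_cat; apply: eqL_mulr.
Qed.

Lemma sim_head p r ps : ev p = ev r -> sim (p :: ps) (r :: ps).
Proof.
move=> hE.
have hp k : ev (flatten (take k (p :: ps))) = ev (flatten (take k (r :: ps))).
  by case: k => [|k] //=; rewrite !ev_cat hE.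
split=> //=.
- by rewrite !ev_cat hE.
- by move=> k; rewrite hp; apply: eqR_refl.
- by case=> [|i] /=; rewrite ?ev_cat ?hE; apply: eqL_refl.
- by case=> [|i] k; rewrite ?drop0 ?hp; apply/eqD_R/eqR_refl.
Qed.

(** * Minimal factorisations into seeded words *)

Definition minimal ps := (forall p, p \in ps -> seeded p) /\
  forall ps1 (b : seq (seq E)) ps2,
    ps = ps1 ++ b ++ ps2 -> seeded (flatten b) -> size b = 1%N.

Lemma minimal_infix ps1 ps ps2 : minimal (ps1 ++ ps ++ ps2) -> minimal ps.
Proof.
case=> hs hm; split=> [p hp | qs1 b qs2 eqs].
  by apply: hs; rewrite !mem_cat hp orbT.
by apply: (hm (ps1 ++ qs1) b (qs2 ++ ps2)); rewrite eqs -!catA.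
Qed.

Lemma minimal_cons p ps : minimal (p :: ps) -> minimal ps.
Proof. by move=> h; apply: (@minimal_infix [:: p] ps [::]); rewrite cats0. Qed.

Lemma minimal_sim ps qs : sim ps qs -> minimal ps -> minimal qs.
Proof.
move=> h [hs hm]; split=> [q | qs1 b qs2 eqs].
  move=> /(nthP [::])[i ltiq <-].
  have ltip : (i < size ps)%N by rewrite (sim_size h).
  have := sim_block h i 1; rewrite (drop_nth [::] ltip) (drop_nth [::] ltiq) /=.
  by rewrite !take0 /= !cats0 => /seeded_eqD; apply; apply/hs/mem_nth.
have szp : size ps = (size qs1 + (size b + size qs2))%N.
  by rewrite (sim_size h) eqs !size_cat.
have := sim_block h (size qs1) (size b).
rewrite eqs drop_size_cat // take_size_cat // => /eqD_sym/seeded_eqD hb /hb.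
move/(hm (take (size qs1) ps) _ (drop (size b) (drop (size qs1) ps))).
rewrite !cat_take_drop => /(_ erefl).
by rewrite size_takel // size_drop szp addKn leq_addr.
Qed.

Lemma minimal_pair ps1 p ps2 q ps3 :
  minimal (ps1 ++ (p :: ps2) ++ q :: ps3) -> ~ seeded (p ++ flatten ps2 ++ q).
Proof.
case=> _ hm; rewrite -flatten_rcons => hs.
have eqps : ps1 ++ (p :: ps2) ++ q :: ps3 = ps1 ++ (p :: rcons ps2 q) ++ ps3.
  by rewrite /= cat_rcons.
by have := hm _ _ _ eqps hs; rewrite /= size_rcons.
Qed.

(** * Minimal factorisations of the same word *)

(** The seed s of q = p x lies in p: if it were in a later factor c' s b', then
    p ... c' s L c' s, and the block from p to that factor would be seeded. *)
Lemma minimal_head_eqR p q x ps z : minimal (p :: ps) -> seeded q ->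
  q = p ++ x -> flatten ps = x ++ z -> eqR (ev p) (ev q).
Proof.
move=> hm [a [s [b [eqq [t hL] [t' hR]]]]] eqx eqf.
rewrite eqx in eqq *.
case: (cat_cons_split eqq) => [[c eqa eqx']|[c eqp eqb]].
- have eqps' : flatten ps = c ++ s :: (b ++ z) by rewrite eqf eqx' -catA.
  have [ps1 [c' [b' [ps2 [eqps eqc _]]]]] := flatten_locate eqps'.
  case: (@minimal_pair [::] p ps1 (c' ++ s :: b') ps2); first by rewrite /= -eqps.
  have hs : seeded (c' ++ s :: b').
    by case: hm => hs _; apply: hs; rewrite eqps inE mem_cat mem_head !orbT.
  apply: seeded_eqL hs; rewrite [ev (p ++ _)]ev_cat [ev (flatten ps1 ++ _)]ev_cat.
  rewrite mulgA; split; last exact: ordL_mull.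
  exists (ev c' * t).
  by rewrite !ev_cat /= {1}hL eqa eqc !ev_cat -!mulgA.
- rewrite ev_cat; split; last exact: ordR_mulr.
  exists (t' * ev c); rewrite eqp ev_cat /= -!mulgA; congr (_ * _).
  by rewrite {1}hR eqb ev_cat -!mulgA.
Qed.

(** The seed of q lies after x: if x = c s e with s a seed of q = c s d, then
    p R p x gives p R p c s R p q, and p q would be seeded. *)
Lemma minimal_second_eqL p q x ps z : minimal (p :: q :: ps) ->
    eqR (ev p) (ev (p ++ x)) -> flatten (q :: ps) = x ++ z ->
  exists2 y, q = x ++ y & eqL (ev q) (ev y).
Proof.
move=> hm hR eqf.
have [c [s [d [eqq [t hL] hR']]]] : seeded q.
  by case: hm => hs _; apply: hs; rewrite !inE eqxx orbT.
have eqxz : x ++ z = c ++ s :: (d ++ flatten ps) by rewrite -eqf /= eqq -catA.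
case: (cat_cons_split eqxz) => [[c' eqc eqz]|[e eqx _]].
  exists (c' ++ s :: d); first by rewrite eqq eqc -catA.
  rewrite eqq eqc -catA ev_cat; split; first exact: ordL_mull.
  by exists (ev c' * t); rewrite ev_cat /= {1}hL eqc !ev_cat -!mulgA.
case: (@minimal_pair [::] p [::] q ps hm).
have hs : seeded p by case: hm => hs _; apply/hs/mem_head.
apply: seeded_eqR hs; rewrite /= ev_cat; split; last exact: ordR_mulr.
case: hR => h _; apply: ordR_trans h _.
rewrite ev_cat; apply: ordR_mull; rewrite eqx eqq !ev_cat; apply: ordR_mull => /=.
exact: ordR_trans (ordR_mulr _ _) hR'.
Qed.

Lemma minimal_nilP ps : minimal ps -> flatten ps = [::] -> ps = [::].
Proof.
case: ps => // p ps [/(_ p (mem_head _ _))]; case: p => [|e p] //.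
by move=> /seeded0.
Qed.

(** If q = p x, the second factor is x y, and a boundary move from p, x y to
    q, y reduces the claim to the tails. *)
Lemma minimal_unique_step p q ps qs : (size p <= size q)%N ->
    (forall ps', (size ps' <= size ps)%N -> minimal ps' ->
       flatten ps' = flatten qs -> sim ps' qs) ->
    minimal (p :: ps) -> minimal (q :: qs) ->
  flatten (p :: ps) = flatten (q :: qs) -> sim (p :: ps) (q :: qs).
Proof.
move=> hsz IH hps hqs /= eqf.
have [x eqq eqf'] : exists2 x, q = p ++ x & flatten ps = x ++ flatten qs.
  case: (cat_eq_split eqf) => -[x eqx eqx']; first by exists x.
  have x0 : x = [::].
    apply/nilP; move: hsz; rewrite eqx size_cat -{2}[size q]addn0 leq_add2l.
    by rewrite leqn0.
  by exists [::]; rewrite ?eqx' ?eqx x0 ?cats0.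
case: ps IH hps eqf eqf' => [|p2 ps] IH hps _ eqf'.
  case: x eqf' eqq => // /esym h; rewrite cats0 => ->.
  by apply/sim_cons/IH => //; apply: minimal_cons hps.
have hR : eqR (ev p) (ev (p ++ x)).
  rewrite -eqq; apply: minimal_head_eqR eqq eqf' => //.
  by case: hqs => hs _; apply/hs/mem_head.
have [y eqp2 hL] := minimal_second_eqL hps hR eqf'.
have hmv : sim [:: p, p2 & ps] [:: q, y & ps].
  by apply: sim_move => //; rewrite eqq // eqp2 -catA.
apply: (sim_trans hmv); apply/sim_cons/IH => //.
- exact: minimal_cons (minimal_sim hmv hps).
- by move: eqf'; rewrite /= eqp2 -catA => /eqP; rewrite eqseq_cat // eqxx => /eqP.
Qed.

Lemma minimal_unique ps qs : minimal ps -> minimal qs ->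
  flatten ps = flatten qs -> sim ps qs.
Proof.
have [n] := ubnP (size ps + size qs); elim: n ps qs => // n IH [|p ps] [|q qs].
- by move=> *; apply: sim_refl.
- by move=> _ _ hq /esym/(minimal_nilP hq).
- by move=> _ hp _ /(minimal_nilP hp).
rewrite /= addSn addnS ltnS => hn hp hq eqf.
case: (leqP (size p) (size q)) => [hpq|/ltnW hpq].
  apply: minimal_unique_step => // ps' hsz hp' eqf'.
  apply: IH => //; last exact: minimal_cons hq.
  by apply: leq_trans (ltnW hn); rewrite ltnS leq_add2r.
apply/sim_sym/minimal_unique_step => // qs' hsz hq' eqf'.
apply: IH => //; last exact: minimal_cons hp.
by apply: leq_trans (ltnW hn); rewrite ltnS addnC leq_add2l.
Qed.

(** * Minimal factorisations along rewriting *)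

Definition transfer u v := forall ps, minimal ps -> flatten ps = u ->
  exists qs, [/\ minimal qs, flatten qs = v & sim ps qs].

Lemma transfer_intro ps1 ps qs v : minimal (ps1 ++ ps) -> sim ps qs ->
    flatten (ps1 ++ qs) = v ->
  exists rs, [/\ minimal rs, flatten rs = v & sim (ps1 ++ ps) rs].
Proof.
move=> hm hs <-; exists (ps1 ++ qs); split=> //; last exact: sim_cat.
by apply: minimal_sim hm; apply: sim_cat.
Qed.

(** Only a step across a boundary p e | f q matters. If g R e, the seed of f q is
    not f, since then p e f q R p e; so it lies in q, and p g | q is obtained by
    a boundary move. If g L f, dually, p | g q is. *)
Lemma transfer_step x e f g y : op e f = Some g ->
  transfer (x ++ e :: f :: y) (x ++ g :: y).
Proof.
move=> efg ps hm eqf; have Eg := gen_op efg.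
have [ps1 [c [b [ps2 [eqps -> eqy]]]]] := flatten_locate eqf.
case: b => [|f' b] in eqps eqy; last first.
  (* e and f lie in the same factor *)
  case: eqy => ? ->; subst f' ps.
  apply: (transfer_intro (qs := (c ++ g :: b) :: ps2) hm); last first.
    by rewrite flatten_cat /= -!catA.
  by apply: sim_head; rewrite !ev_cat /= Eg !mulgA.
case: ps2 => [|r ps2] in eqps eqy; first by [].
have hr : seeded r.
  by case: hm => hs _; apply: hs; rewrite eqps mem_cat !inE eqxx !orbT.
case: r => [|f' q] in hr eqps eqy; first by case: (seeded0 hr).
case: eqy => ? ->; subst f' ps.
have hc : seeded (c ++ [:: e]).
  by case: hm => hs _; apply: hs; rewrite mem_cat mem_head orbT.
have hpair := minimal_pair (ps2 := [::]) hm.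
case: (gen_RL efg) => hRL.
- (* g R e: locate the seed of f q *)
  case: hr => -[|a0 a] [s [b [/= eqr hL hR]]].
    case: eqr => ? ?; subst s b; case: hpair; apply: seeded_eqR hc.
    rewrite [ev (_ ++ f :: q)]ev_cat; split; last exact: ordR_mulr.
    rewrite ev_cat -mulgA; apply: ordR_mull => /=; rewrite mulg1 mulgA -Eg.
    case: hRL => _ h; apply: ordR_trans h _.
    by rewrite {1}Eg Eg -mulgA; apply: ordR_mull.
  case: eqr => ? ?; subst a0 q.
  apply: (transfer_intro (qs := [:: c ++ [:: g], a ++ s :: b & ps2]) hm).
    apply: sim_move.
    - by rewrite !ev_cat /= !mulg1; apply/eqR_mull/eqR_sym.
    - split; first by exists (gen f).
      rewrite /= !ev_cat /= !mulgA; apply: ordL_mulr.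
      rewrite -[gen f * _ * _]mulgA.
      case: hL => t h; exists (ev a * t); rewrite {1}h /=.
      by rewrite -!mulgA.
    - by rewrite !ev_cat /= !mulg1 Eg ?ev_cat -!mulgA.
  by rewrite flatten_cat /= -!catA.
- (* g L f: locate the seed of c e *)
  case: hc => a [s [b [eqce hL hR]]].
  case: (cat_cons_split eqce) => [[z eqa eqe]|[z eqc eqb]].
    case: z eqe eqa => [|? [|? ?]] // [? ?]; subst s b; rewrite cats0 => ?; subst a.
    case: hpair; apply: seeded_eqL hr.
    rewrite ev_cat; split; last exact: ordL_mull.
    rewrite /= ev_cat /= mulg1 !mulgA; apply: ordL_mulr.
    case: hRL => _ h; apply: ordL_trans h _.
    by rewrite Eg; apply: ordL_mulr.
  apply: (transfer_intro (qs := [:: c, g :: q & ps2]) hm).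
    apply: sim_move.
    - rewrite ev_cat; split; first exact: ordR_mulr.
      rewrite eqc ev_cat -mulgA; apply: ordR_mull => /=; rewrite mulg1.
      case: hR => t h; exists (t * ev z); rewrite {1}h eqb ev_cat /= mulg1.
      by rewrite -!mulgA.
    - by rewrite /=; apply: eqL_mulr; apply: eqL_sym.
    - by rewrite !ev_cat /= mulg1 Eg -!mulgA.
  by rewrite flatten_cat /= -!catA.
Qed.

(** The letter g is inside one factor, where e f can be substituted. *)
Lemma transfer_step_back x e f g y : op e f = Some g ->
  transfer (x ++ g :: y) (x ++ e :: f :: y).
Proof.
move=> efg ps hm eqf.
have [ps1 [c [b [ps2 [eqps -> ->]]]]] := flatten_locate eqf; subst ps.
apply: (transfer_intro (qs := (c ++ e :: f :: b) :: ps2) hm).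
  by apply: sim_head; rewrite !ev_cat /= (gen_op efg) !mulgA.
by rewrite flatten_cat /= -!catA.
Qed.

Lemma transfer_ev u v : ev u = ev v -> transfer u v.
Proof.
suff: forall u v, ev u = ev v -> transfer u v /\ transfer v u by move=> H /H [].
have trans w1 w2 w3 : transfer w1 w2 -> transfer w2 w3 -> transfer w1 w3.
  move=> h1 h2 ps hm /(h1 ps hm)[qs [hq /(h2 qs hq)[rs [hr eqr s2]] s1]].
  by exists rs; split=> //; apply: sim_trans s2.
apply: ev_ind => [w|w1 w2 []//|w1 w2 w3 [h1 h2] [h3 h4]|x e f g y efg].
- by split=> ps hm hf; exists ps; split=> //; apply: sim_refl.
- by split; [apply: trans h3 | apply: trans h2].
- by split; [apply: transfer_step | apply: transfer_step_back].
Qed.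

Lemma minimal_sim_ev ps qs : minimal ps -> minimal qs ->
  ev (flatten ps) = ev (flatten qs) -> sim ps qs.
Proof.
move=> hp hq /transfer_ev/(_ _ hp erefl)[rs [hr eqf]] /sim_trans; apply.
exact: minimal_unique.
Qed.

(** * Regular elements are represented by seeded words *)

Lemma minimal_coarsening ps : (forall p, p \in ps -> seeded p) ->
  exists2 qs, minimal qs & flatten qs = flatten ps.
Proof.
have [n] := ubnP (size ps); elim: n ps => // n IH ps hn hs.
have [hm|hm] := pselect (minimal ps); first by exists ps.
have [ps1 [b [ps2 [eqps hb szb]]]] : exists ps1 (b : seq (seq E)) ps2,
    [/\ ps = ps1 ++ b ++ ps2, seeded (flatten b) & size b <> 1%N].
  apply: contrapT => hex; apply: hm; split=> // ps1 b ps2 eqps hb.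
  by apply: contrapT => szb; apply: hex; exists ps1, b, ps2.
have [] := IH (ps1 ++ flatten b :: ps2); last first.
- by move=> qs hq eqq; exists qs => //; rewrite eqq eqps !flatten_cat.
- move=> p; rewrite mem_cat inE => /or3P[hp|/eqP->//|hp];
    by apply: hs; rewrite eqps !mem_cat hp ?orbT.
- case: b => [|? [|? b]] in eqps hb szb *; [by case: (seeded0 hb)|by []|].
  rewrite eqps !size_cat /= ltnS in hn *; apply: leq_trans hn.
  by rewrite -addnS leq_add2l !addSn !ltnS leq_addl.
Qed.

(** A minimal factorisation ps of w is matched with a minimal factorisation qs
    of the longer word w x w; k is the number of factors of qs needed to cover
    the first copy of w. *)
Lemma regular_minimal_size ps x : minimal ps ->
  ev (flatten ps) = ev (flatten ps ++ x ++ flatten ps) -> (size ps <= 1)%N.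
Proof.
have [n] := ubnP (size ps); elim: n ps x => // n IH ps x hn hm hreg.
have [qs [hq eqq hsim]] := transfer_ev hreg hm erefl.
rewrite leqNgt; apply/negP => lt1m.
have [w wE] : exists w, w = flatten ps by exists (flatten ps).
rewrite -wE in hreg eqq.
have exk : exists k, (size w <= size (flatten (take k qs)))%N.
  by exists (size qs); rewrite take_size eqq size_cat leq_addr.
case: (ex_minnP exk) => k hk kmin.
have split_qs j : flatten (take j qs) ++ flatten (drop j qs) = w ++ x ++ w.
  by rewrite -flatten_cat cat_take_drop.
have [z eqz] : exists z, flatten (take k qs) = w ++ z.
  case/cat_eq_split: (split_qs k) => -[y eqy _]; last by exists y.
  exists [::]; move: hk; rewrite eqy size_cat -{2}[size _]addn0 leq_add2l leqn0.
  by move=> /nilP ->; rewrite !cats0.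
have eqw : w = flatten (take k ps) ++ flatten (drop k ps).
  by rewrite wE -flatten_cat cat_take_drop.
have hR : eqR (ev (flatten (take k ps))) (ev w).
  have := sim_prefix hsim k; rewrite eqz => -[h _]; split.
    by apply: ordR_trans h _; rewrite ev_cat; apply: ordR_mulr.
  by rewrite eqw ev_cat; apply: ordR_mulr.
case: (ltnP k (size ps)) => [ltkm|lemk].
  have szk : size (take k ps) = k by rewrite size_takel // ltnW.
  have le_k1 : (k <= 1)%N.
    rewrite -szk; apply: (IH _ (flatten (drop k ps) ++ x)).
    - by rewrite szk; apply: leq_trans ltkm _.
    - by apply: (@minimal_infix [::] _ (drop k ps)); rewrite /= cat_take_drop.
    - case: hR => -[t ht] _.
      by rewrite -catA catA -eqw ev_cat ev_cat ht {1}hreg !ev_cat !mulgA.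
  clear IH exk kmin eqw hn szk hsim eqz.
  case: ps => [|p [|p' ps]] // in hm lt1m hR wE ltkm *.
  have hs : seeded p by case: hm => hs _; apply/hs/mem_head.
  (* p R w, and w starts with p p' *)
  case: k le_k1 => [|[|//]] _ in hk hR ltkm *.
    move: hk; rewrite wE take0 leqn0 /= size_eq0 => /eqP.
    by case: (p) hs => // /seeded0.
  case: (@minimal_pair [::] p [::] p' ps hm); apply: seeded_eqR hs.
  move: hR; rewrite wE /= ?take0 cats0 !ev_cat mulgA => -[h _].
  by split; [apply: ordR_trans h _ | ]; apply: ordR_mulr.
(* the last factor of qs covers the second copy of w *)
have eqk : k = size ps.
  apply/eqP; rewrite eqn_leq lemk andbT (sim_size hsim); apply: kmin.
  by rewrite take_size eqq size_cat leq_addr.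
move: lt1m hm hsim kmin; rewrite {}eqk {IH exk hn lemk hk hR eqz eqw hreg}.
case/lastP: ps => [//|ps p'] in wE *; case/lastP: ps => [//|ps p] in wE *.
rewrite !size_rcons => _ hm hsim kmin.
have [y eqy] : exists y, flatten (drop (size ps).+1 qs) = y ++ w.
  case/cat_eq_split: (split_qs (size ps).+1) => -[y eqy eqy'].
    by exists (y ++ x); rewrite eqy' catA.
  have := kmin (size ps).+1; rewrite eqy size_cat leq_addr ltnn.
  by move/(_ isT).
have := sim_suffix hsim (size ps).+1.
rewrite eqy -[rcons _ p']cats1 drop_size_cat ?size_rcons //=.
rewrite cats0 => -[h _].
case: (@minimal_pair ps p [::] p' [::]); first by rewrite /= -2!cat_rcons cats0.
have hs : seeded p'.
  by case: hm => hs _; apply: hs; rewrite mem_rcons mem_head.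
apply: seeded_eqL hs; split; last by rewrite /= ev_cat; apply: ordL_mull.
apply: ordL_trans h _; rewrite ev_cat; apply: ordL_trans (ordL_mull _ _) _.
by rewrite wE !flatten_rcons -catA ev_cat; apply: ordL_mull.
Qed.

Lemma word_neq0 (w : word E) : val w != [::].
Proof. by case: w. Qed.

Lemma regular_seeded (w : word E) : regular (bar op w) <-> seeded (val w).
Proof.
split.
- case=> c hc; have [x hx] := ev_surj (in1 c).
  (* coarsen the factorisation into letters *)
  have [|ps hm eqf] := @minimal_coarsening [seq [:: e] | e <- val w].
    move=> _ /mapP[e _ ->]; exists [::], e, [::].
    by rewrite /= mul1g mulg1; split=> //; [apply: ordL_refl | apply: ordR_refl].
  rewrite flatten_seq1 in eqf.
  have := @regular_minimal_size ps x hm.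
  rewrite eqf !ev_cat hx ev_val -!in1M mulgA -hc => /(_ erefl).
  case: hm => hs _; case: ps eqf hs => [|p [|//]] /= eqf hs _.
    by case/eqP: (word_neq0 w).
  by rewrite -eqf cats0; apply/hs/mem_head.
- case=> a [s [b [eqw [t hL] [t' hR]]]].
  have [c hc] : exists c, t' * gen s * t = in1 c.
    rewrite /gen; case: t' hR => [t'|] _; case: t hL => [t|] _; by eexists.
  exists c; apply: in1_inj; rewrite !in1M -hc -ev_val eqw ev_cat /=.
  have -> : ev a * (gen s * ev b) * (t' * gen s * t) * (ev a * (gen s * ev b))
     = ev a * (gen s * ev b * t') * gen s * (t * (ev a * gen s)) * ev b.
    by rewrite !mulgA.
  by rewrite -hR -hL -2![ev a * _ * _]mulgA !gen_idem !mulgA.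
Qed.

(** * Minimal r-factorisations *)

Lemma minimal_r_minimal (w : word E) (ps : seq (word E)) :
  minimal_r_factorisation op w ps ->
  minimal (map val ps) /\ flatten (map val ps) = val w.
Proof.
move=> hm; have [[eqw hreg] _] := hm; split=> //.
split=> [_ /mapP[p hp ->] | ps1 b ps2 eqps hb].
  by apply/regular_seeded/hreg.
have hb0 : flatten b != [::] by apply/eqP => h; move: hb; rewrite h => /seeded0.
have eqb : b = map val (take (size b) (drop (size ps1) ps)).
  by rewrite map_take map_drop eqps drop_size_cat // take_size_cat.
have -> : size b = size (take (size b) (drop (size ps1) ps)).
  by rewrite [in LHS]eqb size_map.
apply: (proj1 (minimal_r_factorisationP (proj1 hm)) hm (take (size ps1) ps) _
  (drop (size b) (drop (size ps1) ps)) (Word hb0)).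
- by rewrite !cat_take_drop.
- by rewrite /concat -eqb.
- exact/regular_seeded.
Qed.

End Ig.

(** * The facts used of biordered sets *)

Section Biordered.
Variables (E : Type) (op : E -> E -> option E).
Hypothesis hE : biordered op.

Lemma biordered_opP : exists (S : semigroupType) (psi : E -> S),
  (forall e, psi e * psi e = psi e) /\
  forall e f g, op e f = Some g <->
    basic_pair (psi e) (psi f) /\ psi e * psi f = psi g.
Proof.
have [S [phi [/bij_inj phi_inj phiP]]] := hE; exists S, (fun e => val (phi e)).
split=> [e|e f g]; first exact: eqP (valP (phi e)).
have hphi := phiP e f; split=> [efg | [hb efg]].
- rewrite efg /= in hphi.
  have hb : basic_pair (val (phi e)) (val (phi f)).
    by move: hphi; rewrite /biorder_op; case: ifP.
  by split=> //; have [h hh <-] := biorder_opE hb; move: hphi; rewrite hh => -[->].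
- have [h hh eqh] := biorder_opE hb; move: hphi; rewrite hh.
  have -> : h = phi g by apply: val_inj; rewrite eqh.
  by case: (op e f) => // k [/phi_inj ->].
Qed.

Lemma biordered_op_idem e : op e e = Some e.
Proof.
have [S [psi [psiI opP]]] := biordered_opP.
by apply/opP; rewrite /basic_pair psiI eqxx.
Qed.

(** The alternatives say that g R e (if fe = e or ef = e) or that g L f (if
    fe = f or ef = f). *)
Lemma biordered_op_RL e f g :
  op e f = Some g -> op g e = Some e \/ op f g = Some f.
Proof.
have [S [psi [psiI opP]]] := biordered_opP.
case/opP => /or4P[] /eqP h eqg; [left|right|left|right]; apply/opP.
- by rewrite -eqg h /basic_pair psiI eqxx.
- by rewrite -eqg h /basic_pair psiI eqxx.
- by rewrite -eqg -mulgA h /basic_pair -mulgA h psiI eqxx orbT.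
- by rewrite -eqg mulgA h /basic_pair mulgA h psiI eqxx.
Qed.

End Biordered.

Theorem theorem3p4 (E : finType) (op : E -> E -> option E)
    (hE : biordered op) (u v : word E) (huv : bar op u = bar op v)
    (ps qs : seq (word E))
    (hps : minimal_r_factorisation op u ps)
    (hqs : minimal_r_factorisation op v qs) :
  [/\ size ps = size qs,
      forall i, (i < size ps)%N ->
        greenD (bar op (nth u ps i)) (bar op (nth v qs i)),
      greenR (bar op (head u ps)) (bar op (head v qs)) &
      greenL (bar op (last u ps)) (bar op (last v qs))].
Proof.
have [op_idem op_RL] := (biordered_op_idem hE, @biordered_op_RL _ _ hE).
have [hp eqp] := minimal_r_minimal op_idem op_RL hps.
have [hq eqq] := minimal_r_minimal op_idem op_RL hqs.
have hs : sim op (map val ps) (map val qs).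
  by apply: minimal_sim_ev => //; rewrite eqp eqq !ev_val huv.
have hsz : size ps = size qs by have := sim_size hs; rewrite !size_map.
have factorE w (rs : seq (word E)) i : (i < size rs)%N ->
    ev op (flatten (take 1 (drop i (map val rs)))) = in1 (bar op (nth w rs i)).
  move=> ltir; rewrite (drop_nth [::]) ?size_map //= take0 /= cats0.
  by rewrite (nth_map w) // ev_val.
have ps0 : (0 < size ps)%N.
  rewrite lt0n size_eq0; apply: contra_neq (word_neq0 u) => ps0.
  by rewrite -eqp ps0.
split=> //.
- move=> i ltip; apply: greenD_eqD; rewrite -!factorE -?hsz //.
  exact: sim_block.
- rewrite -!nth0; apply: greenR_eqR; rewrite -!factorE -?hsz // !drop0.
  exact: sim_prefix.
- rewrite -!nth_last; apply: greenL_eqL; rewrite -!factorE -?hsz ?prednK //.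
  have takeE (rs : seq (word E)) : size rs = size ps ->
      take 1 (drop (size ps).-1 (map val rs)) = drop (size ps).-1 (map val rs).
    by move=> h; rewrite take_oversize // size_drop size_map h -subn1 subKn.
  by rewrite !takeE //; apply: sim_suffix.
Qed.
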